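(* Let $L=(\mathbb{N}\times(\mathbb{N}\cup\{\omega\}))\cup\mathbb{N}$ (a disjoint union), ordered by the partial order $\le$ that is the transitive closure of the following relation: $x$ is related to $y$ if and only if one of the following holds: (i) $x=(m,n_1)$, $y=(m,n_2)$, $n_1\le n_2$; (ii) $x=(m,n_1)$, $y=(m,\omega)$; (iii) $x,y\in\mathbb{N}$ and $x\le y$ in $\mathbb{N}$; (iv) $x=(m,n)$, $y\in\mathbb{N}$, $y\ge n$, $m\ge 2$; (v) $x=(1,n_1)$, $y=(m_2,\omega)$, $m_2\ge n_1$; (vi) $x=(m_1,n)$, $y=(m_2,n)$, $m_1\le m_2$, $m_1\ge 2$. Then $L$ is a quasicontinuous poset, but $L$ does not have weak one-step closure. Specifically, for the subset $\mathbb{N}\subseteq L$ one has $(1,\omega)\in cl(\mathbb{N})=L$ while $(1,\omega)\notin\mathbb{N}''$.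
   Context: Here $\mathbb{N}=\{1,2,3,\dots\}$. In (i)–(vi), first coordinates range over $\mathbb{N}$ and second coordinates over $\mathbb{N}\cup\{\omega\}$, where $n\le\omega$ for all $n$. Let $P$ be a poset (not necessarily directed complete). For $A\subseteq P$, $\mathord{\uparrow}A=\{y\in P: x\le y\text{ for some }x\in A\}$ and $\mathord{\downarrow}A=\{y\in P: y\le x\text{ for some }x\in A\}$; $\mathord{\uparrow}x=\mathord{\uparrow}\{x\}$. A directed subset is a nonempty subset $D$ in which every finite subset has an upper bound in $D$. A subset $U$ is Scott open if $U=\mathord{\uparrow}U$ and, for every directed $D$ such that $\sup D$ exists and lies in $U$, $D\cap U\neq\emptyset$. The Scott open sets form the Scott topology, and $cl(A)$ denotes the closure of $A$ in it. Put $A''=\{x\in P\mid \text{there is a directed } D\subseteq\mathord{\downarrow}A\text{ such that }\sup D\text{ exists and }x\le\sup D\}$. The poset $P$ has weak one-step closure if $cl(A)=A''$ for every $A\subseteq P$. For $G,H\subseteq P$, the Smyth preorder is given by $G\le H$ iff $\mathord{\uparrow}H\subseteq\mathord{\uparrow}G$. $G\ll H$ means: for every directed $D\subseteq P$ for which $\sup D$ exists, $\sup D\in\mathord{\uparrow}H$ implies $D\cap\mathord{\uparrow}G\neq\emptyset$. Write $G\ll x$ for $G\ll\{x\}$. The poset $P$ is quasicontinuous if for every $x\in P$: (1) $fin(x)=\{F\subseteq P\mid F\text{ finite},\ F\ll x\}$ is a directed family (with respect to the Smyth preorder); (2) $\mathord{\uparrow}x=\bigcap_{F\in fin(x)}\mathord{\uparrow}F$.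 *)

(* Defs.v *)
From HB Require Import structures.
From Stdlib Require Import Relation_Operators.
From mathcomp Require Import all_boot all_order.
From mathcomp Require Import boolp classical_sets cardinality.
From mathcomp Require Import filter topology_structure.

Set Implicit Arguments.
Unset Strict Implicit.
Unset Printing Implicit Defensive.

Local Open Scope classical_set_scope.
Local Open Scope order_scope.

(* Stated for an arbitrary relation so that it applies both to the order of a *)
(* poset and to the Smyth preorder.                                           *)
Definition directed (T : Type) (r : T -> T -> Prop) (D : set T) : Prop :=
  D !=set0 /\
  forall F : set T, finite_set F -> F `<=` D ->
    exists2 u, D u & forall x, F x -> r x u.

Definition directed_subset (d : Order.disp_t) (P : porderType d) (D : set P) :=
  directed (fun x y : P => x <= y) D.

Definition up (d : Order.disp_t) (P : porderType d) (A : set P) : set P :=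
  [set y | exists2 x, A x & x <= y].

Definition scott_open (d : Order.disp_t) (P : porderType d) (U : set P) : Prop :=
  U = up U /\
  forall (D : set P) (s : P),
    directed_subset D -> isLub D s -> U s -> (D `&` U) !=set0.

Lemma scott_openT (d : Order.disp_t) (P : porderType d) :
  scott_open [set: P].
Proof.
split; first by apply/seteqP; split => x // _; exists x.
by move=> D s [[x Dx] _] _ _; exists x.
Qed.

Lemma scott_openI (d : Order.disp_t) (P : porderType d) :
  setI_closed (@scott_open d P).
Proof.
move=> U V [Uup Uo] [Vup Vo]; split.
  apply/seteqP; split => [x UVx|x [y [Uy Vy] yx]]; first by exists x.
  by split; [rewrite Uup|rewrite Vup]; exists y.
move=> D s Dd Ds [Us Vs].
have [a [Da Ua]] := Uo _ _ Dd Ds Us.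
have [b [Db Vb]] := Vo _ _ Dd Ds Vs.
have [|x [] -> //|u Du ub] := Dd.2 [set a; b].
- by rewrite finite_setU; split; exact: finite_set1.
exists u; split=> //; split.
  by rewrite Uup; exists a => //; apply: ub; left.
by rewrite Vup; exists b => //; apply: ub; right.
Qed.

Lemma scott_open_bigU (d : Order.disp_t) (P : porderType d) (I : Type)
    (f : I -> set P) :
  (forall i, scott_open (f i)) -> scott_open (\bigcup_i f i).
Proof.
move=> fo; split.
  apply/seteqP; split => [x fx|x [y [i _ fy] yx]]; first by exists x.
  by exists i => //; rewrite (fo i).1; exists y.
move=> D s Dd Ds [i _ fs].
have [x [Dx fx]] := (fo i).2 _ _ Dd Ds fs.
by exists x; split=> //; exists i.
Qed.

(* A copy of [P] carrying the Scott topology. *)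
Definition scott (d : Order.disp_t) (P : porderType d) : Type := P.

HB.instance Definition _ (d : Order.disp_t) (P : porderType d) :=
  Choice.on (scott P).

HB.instance Definition _ (d : Order.disp_t) (P : porderType d) :=
  isOpenTopological.Build (scott P) (@scott_openT d P) (@scott_openI d P)
    (@scott_open_bigU d P).

Definition cl (d : Order.disp_t) (P : porderType d) (A : set P) : set P :=
  closure (A : set (scott P)).

(* The set denoted A''. *)
Definition one_step (d : Order.disp_t) (P : porderType d) (A : set P) : set P :=
  [set x | exists D : set P, exists s : P,
    [/\ directed_subset D, D `<=` down A, isLub D s & x <= s]].

Definition weak_one_step_closure (d : Order.disp_t) (P : porderType d) : Prop :=
  forall A : set P, cl A = one_step A.

Definition smyth_le (d : Order.disp_t) (P : porderType d) (G H : set P) : Prop :=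
  up H `<=` up G.

Definition way_below (d : Order.disp_t) (P : porderType d) (G H : set P) : Prop :=
  forall (D : set P) (s : P), directed_subset D -> isLub D s ->
    up H s -> (D `&` up G) !=set0.

Definition fin_below (d : Order.disp_t) (P : porderType d) (x : P) :
    set (set P) :=
  [set F | finite_set F /\ way_below F [set x]].

Definition quasicontinuous (d : Order.disp_t) (P : porderType d) : Prop :=
  forall x : P, directed (@smyth_le d P) (fin_below x) /\
    up [set x] = \bigcap_(F in fin_below x) up F.

Definition posnat : Type := {n : nat | (0 < n)%N}.

Definition posnat1 : posnat := exist _ 1%N isT.

(* N together with omega, the latter being [None]. *)
Definition posnatw : Type := option posnat.

Definition omega : posnatw := None.

Definition lew (a b : posnatw) : bool :=
  match a, b with
  | _, None => true
  | None, Some _ => false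
  | Some m, Some n => (val m <= val n)%N
  end.

Definition L : Type := ((posnat * posnatw) + posnat)%type.

Definition pt (m : posnat) (n : posnatw) : L := inl (m, n).

Definition nt (n : posnat) : L := inr n.

Inductive relL : L -> L -> Prop :=
| relL_i m n1 n2 : lew n1 n2 -> relL (pt m n1) (pt m n2)
| relL_ii m n1 : relL (pt m n1) (pt m omega)
| relL_iii x y : (val x <= val y)%N -> relL (nt x) (nt y)
| relL_iv m n y : lew n (Some y) -> (2 <= val m)%N -> relL (pt m n) (nt y)
| relL_v n1 m2 : lew n1 (Some m2) -> relL (pt posnat1 n1) (pt m2 omega)
| relL_vi m1 m2 n : (val m1 <= val m2)%N -> (2 <= val m1)%N ->
    relL (pt m1 n) (pt m2 n).

Definition leL (x y : L) : bool := `[< clos_trans L relL x y >].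

Lemma leL_refl : reflexive leL.
Proof.
move=> x; apply/asboolP; apply: t_step.
case: x => [[m n]|n]; last exact: relL_iii.
by apply: relL_i; case: n => //=.
Qed.

Lemma leL_trans : transitive leL.
Proof.
by move=> y x z /asboolP xy /asboolP yz; apply/asboolP; apply: t_trans yz.
Qed.

Lemma lew_refl a : lew a a. Proof. by case: a => /=. Qed.

Lemma lew_trans : transitive lew.
Proof. by move=> [b|] [a|] [c|] //=; exact: leq_trans. Qed.

Lemma lew_anti : antisymmetric lew.
Proof.
move=> [a|] [b|] //= /anti_leq ab; congr Some; exact: val_inj.
Qed.

(* The two coordinates, with a point n of the copy of N sent to (omega, n):  *)
(* they are jointly injective and monotone, whence antisymmetry.             *)
Definition coordL (x : L) : posnatw * posnatw :=
  match x with
  | inl (m, n) => (Some m, n)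
  | inr n => (None, Some n)
  end.

Lemma coordL_homo x y : leL x y ->
  lew (coordL x).1 (coordL y).1 /\ lew (coordL x).2 (coordL y).2.
Proof.
move=> /asboolP; elim => {x y} [x y|x y z _ [xy1 xy2] _ [yz1 yz2]].
  case=> //=; intros; split; rewrite ?lew_refl //=; try by case: (n1).
  exact: (valP m2).
by split; [exact: lew_trans yz1|exact: lew_trans yz2].
Qed.

Lemma leL_anti : antisymmetric leL.
Proof.
move=> x y /andP[/coordL_homo[xy1 xy2] /coordL_homo[yx1 yx2]].
have : coordL x = coordL y.
  case: (coordL x) (coordL y) xy1 xy2 yx1 yx2 => [a b] [c e] /= ac be ca eb.
  by rewrite (lew_anti (introT andP (conj ac ca)))
             (lew_anti (introT andP (conj be eb))).
by case: x y {xy1 xy2 yx1 yx2} => [[m n]|n] [[m' n']|n'] //=; case=> -> // ->.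
Qed.

Fact L_display : Order.disp_t. Proof. exact: Order.Disp tt tt. Qed.

HB.instance Definition _ := Choice.on L.

HB.instance Definition _ :=
  Order.Le_isPOrder.Build L_display L leL_refl leL_anti leL_trans.

(* N seen as a subset of L. *)
Definition NL : set L := range nt.

(* Main.v *)
Require Import Defs.
From Stdlib Require Import Relation_Operators.
From mathcomp Require Import all_boot all_order.
From mathcomp Require Import boolp classical_sets cardinality.
From mathcomp Require Import filter topology_structure.
From mathcomp Require Import zify.

Set Implicit Arguments.
Unset Strict Implicit.
Unset Printing Implicit Defensive.

Import Order.POrderTheory.

Local Open Scope classical_set_scope.

(** Why the theorem holds.  Unfolding the transitive closure ([leLE]) shows that
    nothing outside column 1 lies below [pt posnat1 omega], while no point of
    column 1 lies below a point of [NL].  So a directed set inside [down NL]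
    never has a supremum above [pt posnat1 omega] ([one_step_NL]).  Closing
    twice does reach it: for [m >= 2] the points [pt m (Some n)] lie below [NL]
    and have supremum [pt m omega]; every [pt posnat1 (Some n)] lies below one of
    these suprema, and [pt posnat1 omega] is the supremum of column 1.  The same
    chain of steps shows that every nonempty Scott open set meets [NL]
    ([scott_open_meets_NL]).

    For quasicontinuity, [scott_open_colge] and [scott_open_rowge] say that
    bounding either coordinate from below by a finite value is a Scott open
    condition.  A point [pt m (Some n)] with [m >= 2] is therefore compact: its
    upper set is the intersection of two such sets.  Every [fin_below x] then
    has a decreasing cofinal sequence F_j whose upper sets intersect in the
    upper set of [x] ([quasicontinuous_at]):
    - [x = pt m (Some n)], [m >= 2]: the constant {x};
    - [x = nt k]: {(j + 2, k)};
    - [x = pt m omega], m arbitrary: {(m, j + 1)};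
    - [x = pt posnat1 (Some n)]: {x, (max n 2, j + 1)}.
    The last case is the only one that needs two points: the columns with index
    at least [max n 2] converge to points above [x] without meeting column 1. *)

(** * Directed sets and quasicontinuity *)

Lemma directedP (T : choiceType) (r : T -> T -> Prop) (D : set T) :
  (forall x, r x x) -> (forall x y z, r x y -> r y z -> r x z) ->
  D !=set0 ->
  (forall x y, D x -> D y -> exists2 u, D u & r x u /\ r y u) ->
  directed r D.
Proof.
move=> rr rt D0 Db; split=> // F /finite_seqP[s ->] {F}.
elim: s => [|a s IH] sD; first by case: D0 => u Du; exists u.
have [|v Dv sv] := IH; first by move=> x /= xs; apply: sD; rewrite /= inE xs orbT.
have [|u Du [au vu]] := Db a v _ Dv; first by apply: sD; rewrite /= mem_head.
exists u => // x /=; rewrite inE => /orP[/eqP-> //|/sv xv].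
exact: rt xv vu.
Qed.

(** Used on a directed set that is bounded in one coordinate: beyond a point
    where that coordinate is maximal, it stays constant. *)
Lemma bounded_max (T : Type) (c : T -> nat) (b : nat) (D : set T) : D !=set0 ->
  (forall x, D x -> (c x <= b)%N) ->
  exists2 x, D x & forall y, D y -> (c y <= c x)%N.
Proof.
move=> [x0 Dx0] Db.
have ex : exists i, `[< exists2 x, D x & c x = i >].
  by exists (c x0); apply/asboolP; exists x0.
have ub i : `[< exists2 x, D x & c x = i >] -> (i <= b)%N.
  by move=> /asboolP[x Dx <-]; exact: Db.
case: (ex_maxnP ex ub) => _ /asboolP[x Dx <-] cx; exists x => // y Dy.
by apply: cx; apply/asboolP; exists y.
Qed.

Section Posets.
Context {d : Order.disp_t} {P : porderType d}.
Implicit Types (x y s : P) (D G : set P).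
Local Open Scope order_scope.

Lemma directed_pair D x y : directed_subset D -> D x -> D y ->
  exists2 u, D u & x <= u /\ y <= u.
Proof.
move=> [_ Db] Dx Dy; have [||u Du ub] := Db [set x; y].
- by rewrite finite_setU; split; exact: finite_set1.
- by move=> z [->|->].
- by exists u => //; split; apply: ub; [left|right].
Qed.

Lemma directed_chain (f : nat -> P) :
  (forall i j, (i <= j)%N -> f i <= f j) -> directed_subset (range f).
Proof.
move=> fh; apply: directedP => //.
- by move=> x y z; exact: le_trans.
- by exists (f 0), 0.
- move=> _ _ [i _ <-] [j _ <-]; exists (f (maxn i j)); first by exists (maxn i j).
  by split; apply: fh; rewrite ?leq_maxl ?leq_maxr.
Qed.

Lemma directed1 x : directed_subset [set x].
Proof.
apply: directedP => //; first by move=> a b c; exact: le_trans.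
  by exists x.
by move=> _ _ -> ->; exists x.
Qed.

Lemma isLub1 x : isLub [set x] x.
Proof. by split=> [_ -> //|b]; apply. Qed.

Lemma up_closed (G : set P) x y : x <= y -> up G x -> up G y.
Proof.
by move=> xy [z Gz zx]; exists z => //; exact: le_trans xy.
Qed.

(** The definition is tested on the directed set {x}. *)
Lemma way_below_up G x : way_below G [set x] -> up G x.
Proof.
move=> Gx; have [|y [-> //]] := Gx _ _ (directed1 x) (isLub1 x).
by exists x.
Qed.

Lemma way_below_chain G x s (f : nat -> P) :
  way_below G [set x] -> (forall i j, (i <= j)%N -> f i <= f j) ->
  isLub (range f) s -> x <= s -> exists i, up G (f i).
Proof.
move=> Gx fh fs xs; have [|_ [[i _ <-] Gi]] := Gx _ _ (directed_chain fh) fs.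
  by exists x.
by exists i.
Qed.

Lemma scott_open_way_below G x :
  scott_open (up G) -> up G x -> way_below G [set x].
Proof.
move=> [_ Go] Gx D s Dd Ds [_ -> xs]; apply: Go Dd Ds _; exact: up_closed Gx.
Qed.

(** [fin_below x] may be replaced by a decreasing sequence cofinal in it: this
    gives directedness, and only one inclusion of the second condition is left
    to check, since every member of [fin_below x] has [x] in its upper set. *)
Lemma quasicontinuous_at (F : nat -> set P) x :
  (forall j, finite_set (F j)) ->
  (forall i j, (i <= j)%N -> F j `<=` up (F i)) ->
  (forall j, way_below (F j) [set x]) ->
  (forall G, way_below G [set x] -> exists j, F j `<=` up G) ->
  (forall y, (forall j, up (F j) y) -> x <= y) ->
  directed (@smyth_le d P) (fin_below x) /\
    up [set x] = \bigcap_(G in fin_below x) up G.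
Proof.
move=> Ff Fh Fx Fc Fi.
have upS (G H : set P) : G `<=` up H -> up G `<=` up H.
  by move=> GH y [z /GH Hz zy]; exact: up_closed Hz.
split; last first.
  apply/seteqP; split=> [y [_ -> xy] G [_ /way_below_up]|y yG].
    exact: up_closed.
  by exists x => //; apply: Fi => j; apply: yG; split.
apply: directedP.
- by move=> G y.
- by move=> A B C AB BC y /BC /AB.
- by exists (F 0); split.
- move=> G H [_ /Fc[i iG]] [_ /Fc[j jH]]; exists (F (maxn i j)); first by split.
  split; apply: (upS) => y /Fh h.
    exact: upS iG _ (h _ (leq_maxl _ _)).
  exact: upS jH _ (h _ (leq_maxr _ _)).
Qed.

Lemma cl_setT (A : set P) :
  (forall U x, scott_open U -> U x -> A `&` U !=set0) -> cl A = [set: P].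
Proof.
move=> h; apply/seteqP; split=> // x _; rewrite /cl closureEonbhs => B U AB [Uo Ux].
have [y [Ay Uy]] := h U x Uo Ux.
by exists y; split=> //; apply: AB.
Qed.

End Posets.

(** * The order of L in closed form *)

Lemma posnat_le1 (m : posnat) : (val m <= 1)%N -> m = posnat1.
Proof. by move=> m1; apply/val_inj/anti_leq/andP; split=> //; exact: valP m. Qed.

Lemma posnat_le_anti (m n : posnat) : (val m <= val n)%N -> (val n <= val m)%N -> m = n.
Proof. by move=> mn nm; apply/val_inj/anti_leq/andP. Qed.

(** In the first branch for two points of the plane, the columns with index at
    least 2 and their order by coordinates; in the second, column 1, from which
    the only way out is to a point [pt m' omega] with [m'] at least the finite
    height [n]. *)
Definition ordL (x y : L) : bool :=
  match x, y with
  | inr j, inr k => (val j <= val k)%N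
  | inr _, inl _ => false
  | inl (m, n), inr k => (1 < val m)%N && lew n (Some k)
  | inl (m, n), inl (m', n') =>
      if (1 < val m)%N then (val m <= val m')%N && lew n n'
      else (val m' <= 1)%N && lew n n' || lew omega n' && lew n (Some m')
  end.

Lemma ordL_trans x y z : ordL x y -> ordL y z -> ordL x z.
Proof.
case: x => [[m [n|]]|n]; case: y => [[m' [n'|]]|n']; case: z => [[m'' [n''|]]|n'']; rewrite /ordL /=;
repeat case: ifP => //; lia.
Qed.

Lemma ordL_rel x y : relL x y -> ordL x y.
Proof.
case=> {x y} [m n1 n2|m n1|//|m n y|n1 m2|m1 m2 n] /=.
- case: n1 n2 => [?|] [?|] //=; case: ifP; lia.
- case: n1 => [?|] //=; case: ifP; lia.
- case: n => [?|] //=; lia.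
- case: n1 => [?|] //=; lia.
- case: n => [?|] //=; case: ifP; lia.
Qed.

Lemma leLE (x y : L) : (x <= y)%O = ordL x y.
Proof.
apply/idP/idP => [/asboolP|].
  by elim=> {x y} [x y /ordL_rel //|x y z _ xy _ yz]; exact: ordL_trans yz.
case: x y => [[m n]|j] [[m' n']|k] //=; last first.
- by move=> jk; apply/asboolP; apply: t_step; exact: relL_iii.
- by move=> /andP[m1 nk]; apply/asboolP; apply: t_step; exact: relL_iv.
case: ltnP => [m1 /andP[mm' nn']|m1].
  apply/asboolP; apply: (t_trans _ _ _ (pt m' n)); apply: t_step.
    exact: relL_vi.
  exact: relL_i.
have -> : m = posnat1 by exact: posnat_le1.
move=> /orP[/andP[m'1 nn']|/andP[n'w nm']]; apply/asboolP; apply: t_step.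
  have -> : m' = posnat1 by exact: posnat_le1.
  exact: relL_i.
by case: n' n'w => // _; exact: relL_v.
Qed.

Lemma col1_omega_max (s : L) : (pt posnat1 omega <= s)%O -> s = pt posnat1 omega.
Proof.
rewrite leLE; case: s => [[m [r|]]|k] //=; first by rewrite andbF.
by rewrite andbT orbF => m1; rewrite (posnat_le1 m1).
Qed.

(** * Two families of suprema *)

(** Shifted by one, so that sequences in [posnat] can be indexed from 0. *)
Definition mk (j : nat) : posnat := exist _ j.+1 isT.

Lemma lub_omega m :
  isLub (range (fun j => pt m (Some (mk j)))) (pt m omega).
Proof.
split=> [_ [j _ <-]|b ub].
  by rewrite leLE /=; case: ifP => //= h; rewrite ?leqnn //; lia.
have {}ub j : ordL (pt m (Some (mk j))) b by rewrite -leLE; apply: ub; exists j.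
rewrite leLE; case: b ub => [[m' [n'|]]|k] ub.
- by have := ub (val n'); rewrite /=; case: ifP; lia.
(* If m = 1, the point of height m' + 1 is not below the other points pt m' omega. *)
- by have := ub (val m'); rewrite /=; case: ifP; lia.
- by have := ub (val k); rewrite /=; lia.
Qed.

(** The row starts in column 2, since column 1 is not below [nt k].  A point of
    column [m'] cannot bound it, as the row meets column [m' + 2]. *)
Lemma lub_nt k :
  isLub (range (fun j => pt (mk j.+1) (Some k))) (nt k).
Proof.
split=> [_ [j _ <-]|b ub]; first by rewrite leLE /=.
have {}ub j : ordL (pt (mk j.+1) (Some k)) b by rewrite -leLE; apply: ub; exists j.
rewrite leLE; case: b ub => [[m' n']|k'] ub; last exact: ub 0.
by have := ub (val m'); rewrite /=; lia.
Qed.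

(** * Scott open sets of L *)

(** For a point [nt k] the first coordinate counts as omega, so that [colge m]
    contains [NL]. *)
Definition colge (m : posnat) : set L := [set x | lew (Some m) (coordL x).1].
Definition rowge (n : posnat) : set L := [set x | lew (Some n) (coordL x).2].

Lemma up_sub_id (U : set L) :
  (forall x y : L, (x <= y)%O -> U x -> U y) -> U = up U.
Proof.
move=> h; apply/seteqP; split=> [x Ux|x [y Uy /h]]; last exact.
by exists x.
Qed.

(** Suppose that a directed [D] stays in columns below [m].  If [p] is the largest
    column index attained, then [D] is cofinal in column [p], and [pt p omega] is
    an upper bound; so the supremum of [D] is not in [colge m] either. *)
Lemma scott_open_colge m : scott_open (colge m).
Proof.
split.
  by apply: up_sub_id => x y /coordL_homo[xy _] mx; exact: lew_trans mx xy.
move=> D s Dd [sub sl] ms; apply: contrapT => D0.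
have Dm x : D x -> exists2 p, x = pt p.1 p.2 & (val p.1 < val m)%N.
  move=> Dx; have {}D0 : ~ colge m x by move=> mx; apply: D0; exists x.
  case: x D0 {Dx} => [[p q]|k] /= h; last by case: h.
  by exists (p, q) => //; rewrite ltnNge; apply/negP.
pose c (x : L) := if x is inl p then val p.1 else 0.
have [|x Dx xmax] := @bounded_max _ c (val m) D Dd.1.
  by move=> x /Dm[p ->] /ltnW.
have [[p q] /= xE pm] := Dm _ Dx.
suff /sl/coordL_homo[sw _] : ubound D (pt p omega).
  by have /= := @lew_trans _ (Some m) _ ms sw; lia.
move=> y Dy; have [u Du [xu yu]] := directed_pair Dd Dx Dy.
apply: (le_trans yu).
have [[p' q'] /= uE _] := Dm _ Du.
have := xmax _ Du; move: xu => /coordL_homo[]; rewrite xE uE /= => pp' _ p'p.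
have <- : p = p' by exact: posnat_le_anti.
by rewrite leLE /=; case: ifP => h; [rewrite leqnn; case: q' {uE}|case: q' {uE} => /=; lia].
Qed.

(** Suppose that a directed [D] stays in rows below [n].  Let [x] be a point of [D]
    whose row [q] is largest; then [D] is cofinal in row [q], and it is enough to
    find an upper bound of [D] in that row.  If [x] lies in column 1, it is the
    only point of row [q] above [x], hence the greatest element of [D];
    otherwise [nt q] is an upper bound. *)
Lemma scott_open_rowge n : scott_open (rowge n).
Proof.
split.
  by apply: up_sub_id => x y /coordL_homo[_ xy] nx; exact: lew_trans nx xy.
move=> D s Dd [sub sl] ns; apply: contrapT => D0.
have Dn x : D x -> exists2 q, (coordL x).2 = Some q & (val q < val n)%N.
  move=> Dx; have : ~ rowge n x by move=> nx; apply: D0; exists x.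
  rewrite /rowge /=; case: (coordL x).2 => [q|] //= /negP; rewrite -ltnNge.
  by exists q.
pose c (x : L) := if (coordL x).2 is Some q then val q else 0.
have [|x Dx xmax] := @bounded_max _ c (val n) D Dd.1.
  by move=> x /Dn[q]; rewrite /c => -> /ltnW.
have [q /= xE qn] := Dn _ Dx.
have Du2 u : D u -> (x <= u)%O -> (coordL u).2 = Some q.
  move=> Du xu; have := xmax _ Du; have [q' uE _] := Dn _ Du.
  move: xu => /coordL_homo[_]; rewrite /c xE uE /= => qq' q'q.
  by congr Some; exact: posnat_le_anti.
suff [t [ubt tq]] : exists t, ubound D t /\ (coordL t).2 = Some q.
  have /coordL_homo[_ st] := sl _ ubt.
  by have := @lew_trans _ (Some n) _ ns st; rewrite tq /=; lia.
have [x1|x1] := pselect (lew (coordL x).1 (Some posnat1)).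
  exists x; split=> // y Dy; have [u Du [xu yu]] := directed_pair Dd Dx Dy.
  suff -> : x = u by [].
  have := Du2 _ Du xu; move: xu; rewrite leLE.
  case: x u x1 xE {Dx xmax Du2 Du yu} => [[m r]|j] [[m' r']|k] //= m1 -> + ur.
    rewrite ltnNge m1 ur /= orbF => /andP[m'1 _].
    by rewrite (posnat_le1 m1) (posnat_le1 m'1).
  by rewrite ltnNge m1.
exists (nt q); split=> // y Dy; have [u Du [xu yu]] := directed_pair Dd Dx Dy.
apply: (le_trans yu).
have := Du2 _ Du xu; move: xu; rewrite !leLE.
case: x u x1 xE {Dx xmax Du2 Du yu} => [[m r]|j] [[m' r']|k] //= m1 nq.
- have {}m1 : (1 < val m)%N by rewrite ltnNge; apply/negP.
  by rewrite m1 => /andP[mm' _] ->; rewrite /= leqnn (leq_trans m1).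
- by move=> _ [->].
- by move=> _ [->].
Qed.

(** This fails in column 1, whose points are not below the points of finite
    height in the other columns. *)
Lemma up_pt m n : (1 < val m)%N ->
  up [set pt m (Some n)] = colge m `&` rowge n.
Proof.
move=> m1; apply/seteqP; split=> [x [_ -> /coordL_homo[]] //|x [mx nx]].
exists (pt m (Some n)) => //; rewrite leLE; case: x mx nx => [[m' r]|k] mx nx.
  by rewrite /= m1; apply/andP.
by rewrite /= m1.
Qed.

Lemma scott_open_up_pt m n : (1 < val m)%N ->
  scott_open (up [set pt m (Some n)]).
Proof.
move=> m1; rewrite up_pt //.
by apply: scott_openI; [exact: scott_open_colge|exact: scott_open_rowge].
Qed.

Lemma pt_le m n q : lew n q -> (pt m n <= pt m q)%O.
Proof. by move=> nq; rewrite leLE /ordL /pt leqnn nq /=; case: ltnP => // ->. Qed.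

Lemma pt_mk_le m i j : (i <= j)%N ->
  (pt m (Some (mk i)) <= pt m (Some (mk j)))%O.
Proof. by move=> ij; exact: pt_le. Qed.

(** Every point below [pt posnat1 r] lies in column 1, hence so does [D]; the
    height condition then comes from [scott_open_rowge].  The default [val n] makes
    the last hypothesis vacuous when [r] is omega. *)
Lemma directed_below_col1 (D : set L) n r : directed_subset D ->
  isLub D (pt posnat1 r) -> (val n <= oapp val (val n) r)%N ->
  exists2 q, D (pt posnat1 q) & lew (Some n) q.
Proof.
move=> Dd Ds nr; have [_ h] := scott_open_rowge n.
have [|x [Dx nx]] := h _ _ Dd Ds; first by case: r nr {Ds}.
have := Ds.1 _ Dx; rewrite leLE; case: x Dx nx => [[m q]|k] //= Dx nx.
case: ltnP => [m1 /andP[]|/posnat_le1 m1 _] //.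
by exists q => //; rewrite -m1.
Qed.

(** The upper set of [pt posnat1 (Some n)] is not Scott open, as it contains
    [pt m omega] for large [m] but nothing else of column [m].  The relation holds
    because [pt posnat1 omega] is maximal, so that only directed sets
    converging to that very point have to be considered. *)
Lemma way_below_col1_omega n :
  way_below [set pt posnat1 (Some n)] [set pt posnat1 omega].
Proof.
move=> D s Dd Ds [_ -> /= sw].
rewrite (col1_omega_max sw) in Ds; have [|q Dq nq] := @directed_below_col1 D n _ Dd Ds.
  by rewrite /=.
exists (pt posnat1 q); split=> //; exists (pt posnat1 (Some n)) => //.
exact: pt_le.
Qed.

(** The maximum of [n] and 2: the first column other than column 1 whose point at
    height omega is above [pt posnat1 (Some n)]. *)
Definition mk2 (n : posnat) : posnat := mk (maxn (val n) 2).-1.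

(** A supremum above [pt posnat1 (Some n)] is either in column 1, where
    [directed_below_col1] gives a term of the directed set above
    [pt posnat1 (Some n)], or equal to [pt m omega] with [m] at least [mk2 n],
    where compactness of the second point applies. *)
Lemma way_below_col1 n j :
  way_below [set pt posnat1 (Some n); pt (mk2 n) (Some j)]
            [set pt posnat1 (Some n)].
Proof.
have m1 : (1 < val (mk2 n))%N by rewrite /=; lia.
move=> D s Dd Ds [_ -> ns].
suff [h|[r [sE nr]]] : up [set pt (mk2 n) (Some j)] s \/
    exists r, s = pt posnat1 r /\ (val n <= oapp val (val n) r)%N.
- have [x [Dx [y -> yx]]] := (scott_open_up_pt j m1).2 D s Dd Ds h.
  by exists x; split=> //; exists (pt (mk2 n) (Some j)) => //; right.
- rewrite sE in Ds; have [q Dq nq] := directed_below_col1 Dd Ds nr.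
  exists (pt posnat1 q); split=> //; exists (pt posnat1 (Some n)); first by left.
  exact: pt_le.
have [m2|m2] := pselect (colge (mk2 n) s).
  left; rewrite up_pt //; split=> //.
  move: ns m2; rewrite leLE; case: s {Ds} => [[m [r|]]|k] //=.
  by rewrite orbF /colge /= => /andP[m1' _]; lia.
right; move: ns m2; rewrite leLE; case: s {Ds} => [[m r]|k] //= + m2.
have {}m2 : (val m < val (mk2 n))%N by rewrite ltnNge; apply/negP.
move=> nm; exists r.
have m1' : (val m <= 1)%N.
  by move: nm m2 => /orP[/andP[]//|/andP[_] /=]; lia.
rewrite (posnat_le1 m1'); split=> //.
by case: r nm => [r|] /=; [rewrite orbF => /andP[]|].
Qed.

(** * Quasicontinuity *)

Lemma quasicontinuous_L : quasicontinuous L.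
Proof.
case=> [[m [n|]]|k].
- have [m1|m1] := ltnP 1 (val m).
    apply: (quasicontinuous_at (F := fun=> [set pt m (Some n)])) => //.
    + by move=> _ _ _ _ ->; exists (pt m (Some n)).
    + move=> _; apply: scott_open_way_below; first exact: scott_open_up_pt.
      by exists (pt m (Some n)).
    + by move=> G /way_below_up Gx; exists 0 => _ ->.
    + by move=> y /(_ 0)[_ -> ].
  rewrite (posnat_le1 m1).
  pose F j := [set pt posnat1 (Some n); pt (mk2 n) (Some (mk j))].
  apply: (quasicontinuous_at (F := F)).
  + by move=> j; rewrite finite_setU; split; exact: finite_set1.
  + move=> i j ij _ [->|->]; first by exists (pt posnat1 (Some n)) => //; left.
    by exists (pt (mk2 n) (Some (mk i))); [right|exact: pt_mk_le].
  + by move=> j; exact: way_below_col1.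
  + move=> G Gx; have [||j Gj] := way_below_chain Gx _ (lub_omega (mk2 n)).
    * by move=> i j; exact: pt_mk_le.
    * by rewrite leLE /=; lia.
    by exists j => _ [->|-> //]; exact: way_below_up.
  + move=> y Fy.
    (* The index exceeds the height of y if that is finite, which puts y at
       height omega in the second alternative. *)
    have [_ [->|->]] // := Fy (oapp val 0 (coordL y).2).
    rewrite !leLE; case: y {Fy} => [[m' [r|]]|k] /=; try lia; case: ifP; lia.
- have [m1|m1] := ltnP 1 (val m).
    apply: (quasicontinuous_at (F := fun j => [set pt m (Some (mk j))])) => //.
    + by move=> i j ij _ ->; exists (pt m (Some (mk i))) => //; exact: pt_mk_le.
    + move=> j; apply: scott_open_way_below; first exact: scott_open_up_pt.
      by rewrite up_pt //; split=> //; exact: leqnn.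
    + move=> G Gx; have [||j Gj] := way_below_chain Gx _ (lub_omega m) => //.
        by move=> i j; exact: pt_mk_le.
      by exists j => _ ->.
    + move=> y Fy; have [_ ->] := Fy (oapp val 0 (coordL y).2).
      by rewrite !leLE; case: y {Fy} => [[m' [r|]]|k] /=; rewrite ?m1 //=; lia.
  rewrite (posnat_le1 m1).
  apply: (quasicontinuous_at (F := fun j => [set pt posnat1 (Some (mk j))])) => //.
  + by move=> i j ij _ ->; exists (pt posnat1 (Some (mk i))) => //; exact: pt_mk_le.
  + by move=> j; exact: way_below_col1_omega.
  + move=> G Gx; have [||j Gj] := way_below_chain Gx _ (lub_omega posnat1) => //.
      by move=> i j; exact: pt_mk_le.
    by exists j => _ ->.
  + move=> y Fy.
    (* For this index F_j is above both the height of y, if finite, and its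
       column, which leaves only pt posnat1 omega. *)
    have [_ ->] := Fy (oapp val 0 (coordL y).1 + oapp val 0 (coordL y).2).
    by rewrite !leLE; case: y {Fy} => [[m' [r|]]|k] /=; lia.
- apply: (quasicontinuous_at (F := fun j => [set pt (mk j.+1) (Some k)])) => //.
  + move=> i j ij _ ->; exists (pt (mk i.+1) (Some k)) => //.
    by rewrite leLE /=; lia.
  + move=> j; apply: scott_open_way_below; first exact: scott_open_up_pt.
    by rewrite up_pt //; split=> //; exact: leqnn.
  + move=> G Gx; have [||j Gj] := way_below_chain Gx _ (lub_nt k) => //.
      by move=> i j ij; rewrite leLE /=; lia.
    by exists j => _ ->.
  + move=> y Fy; have [_ ->] := Fy (oapp val 0 (coordL y).1).
    by rewrite !leLE; case: y {Fy} => [[m' r]|k'] /=; lia.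
Qed.

(** * The closure of N *)

(** The inner steps descend from [x]: from [pt m omega] to a finite point of its
    column, from [pt posnat1 (Some n)] up to [pt (mk2 n) omega] and down into
    that column, and from there up to [NL]. *)
Lemma scott_open_meets_NL (U : set L) x : scott_open U -> U x -> NL `&` U !=set0.
Proof.
move=> [Uup Uo].
have Ule (y z : L) : (y <= z)%O -> U y -> U z.
  by move=> yz Uy; rewrite Uup; exists y.
have Ufin m n : (1 < val m)%N -> U (pt m (Some n)) -> NL `&` U !=set0.
  move=> m1 Umn; exists (nt n); split; first by exists n.
  by apply: Ule Umn; rewrite leLE /= m1 /=.
have Uomega m : U (pt m omega) -> exists n, U (pt m (Some n)).
  have Dd := directed_chain (@pt_mk_le m).
  by move=> /(Uo _ _ Dd (lub_omega m))[_ [[j _ <-] Uj]]; exists (mk j).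
have Ucol1 n : U (pt posnat1 (Some n)) -> NL `&` U !=set0.
  move=> U1; have [|q] := Uomega (mk2 n).
    by apply: Ule U1; rewrite leLE /=; lia.
  by apply: Ufin => /=; lia.
have Ucol m n : U (pt m (Some n)) -> NL `&` U !=set0.
  have [m1|/posnat_le1->] := ltnP 1 (val m); [exact: Ufin|exact: Ucol1].
case: x => [[m [n|]]|k]; [exact: Ucol|by move=> /Uomega[n /Ucol]|].
by move=> Uk; exists (nt k); split=> //; exists k.
Qed.

Lemma cl_NL : cl NL = [set: L].
Proof. by apply: cl_setT => U x; exact: scott_open_meets_NL. Qed.

Lemma one_step_NL : ~ one_step NL (pt posnat1 omega).
Proof.
move=> [D [s [Dd DN Ds xs]]].
have [[x Dx] _] := Dd.
have [_ [[k _ <-]]] := DN _ Dx; have := Ds.1 _ Dx; rewrite (col1_omega_max xs) !leLE.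
by case: x {Dx} => [[m r]|j] //=; case: ifP => //; lia.
Qed.

Theorem mainTheorem2 :
  quasicontinuous L /\
  ~ weak_one_step_closure L /\
  cl NL (pt posnat1 omega) /\
  cl NL = [set: L] /\
  ~ one_step NL (pt posnat1 omega).
Proof.
have clx : cl NL (pt posnat1 omega) by rewrite cl_NL.
split; first exact: quasicontinuous_L.
split; first by move=> /(_ NL) clE; apply: one_step_NL; rewrite -clE.
split=> //; split; [exact: cl_NL|exact: one_step_NL].
Qed.
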